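(* Let $X$ be any (real) Banach space and let $K\subset X$ be a compact set that is convex and centrally symmetric about the origin. Then for every $n\in\mathbb{N}$, $n\ge 1$, $$d_n^r(K)_X=d_n^g(K)_X=\lim_{\gamma\to\infty}d_n^{c,\gamma}(K)_X.$$
   Context: Let $K$ be a compact subset of a Banach space $X$ and $n\ge 1$. Restricted Kolmogorov width: let $\mathcal{X}(K)$ be the closure in $X$ of the linear span of $K$. Then $$d_n^r(K)_X:=\inf_{V\subset \mathcal{X}(K),\ \dim V\le n}\ \sup_{f\in K}\ \inf_{v\in V}\|f-v\|_X,$$ the outer infimum being over linear subspaces $V$ of $\mathcal{X}(K)$. Greedy Kolmogorov width: $$d_n^g(K)_X:=\inf_{f_1,\dots,f_n\in K}\ \sup_{f\in K}\ \inf_{v\in \mathrm{span}\{f_1,\dots,f_n\}}\|f-v\|_X .$$ $\gamma$-constrained Kolmogorov width: for $\gamma\ge 1$ let $K_\gamma:=\bigcup_{0\le\lambda\le\gamma}\lambda K$. Then $$d_n^{c,\gamma}(K)_X:=\inf_{V\subset X,\ \dim V\le n}\ \sup_{f\in K}\ \inf_{v\in V\cap K_\gamma}\|f-v\|_X,$$ the outer infimum being over linear subspaces $V$ of $X$. It is non-increasing in $\gamma$, so the limit as $\gamma\to\infty$ exists. *)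

(* Defs.v *)
From HB Require Import structures.
From mathcomp Require Import all_boot all_order all_algebra.
From mathcomp Require Import all_classical all_reals all_analysis.

Set Implicit Arguments.
Unset Strict Implicit.
Unset Printing Implicit Defensive.

Import Order.TTheory GRing.Theory Num.Theory.
Import numFieldNormedType.Exports.

Local Open Scope classical_set_scope.
Local Open Scope ring_scope.

Section LinearAlgebra.
Context {R : realType} {X : lmodType R}.

(* The case m = 0 puts 0 in every span, including that of the empty set. *)
Definition lspan (A : set X) : set X :=
  [set x | exists (m : nat) (a : 'I_m -> R) (v : 'I_m -> X),
     (forall i, A (v i)) /\ x = \sum_(i < m) a i *: v i].

Definition lin_indep (m : nat) (e : 'I_m -> X) : Prop :=
  forall a : 'I_m -> R, \sum_(i < m) a i *: e i = 0 -> forall i, a i = 0.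

Definition has_dim (V : set X) (m : nat) : Prop :=
  exists e : 'I_m -> X, lin_indep e /\ lspan (range e) = V.

Definition subspace_dim_le (V : set X) (n : nat) : Prop :=
  submod_closed (mem V) /\ exists m : nat, (m <= n)%N /\ has_dim V m.

End LinearAlgebra.

Section Widths.
Context {R : realType} {X : completeNormedModType R}.

(* Infima and suprema are taken in \bar R, so that none of them takes a
   default value; a distance to the empty set is +oo. *)
Definition dist (f : X) (A : set X) : \bar R :=
  ereal_inf [set `|f - v|%:E | v in A].

Definition deviation (K A : set X) : \bar R :=
  ereal_sup [set dist f A | f in K].

Definition width_restricted (K : set X) (n : nat) : \bar R :=
  ereal_inf [set deviation K V | V in
    [set V : set X | V `<=` closure (lspan K) /\ subspace_dim_le V n]].

Definition width_greedy (K : set X) (n : nat) : \bar R :=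
  ereal_inf [set deviation K (lspan (range f)) | f in
    [set f : 'I_n -> X | forall i, K (f i)]].

Definition dilation_hull (gamma : R) (K : set X) : set X :=
  [set x | exists (lambda : R) (f : X),
     [/\ 0 <= lambda, lambda <= gamma, K f & x = lambda *: f]].

Definition width_constrained (K : set X) (n : nat) (gamma : R) : \bar R :=
  ereal_inf [set deviation K (V `&` dilation_hull gamma K) | V in
    [set V : set X | subspace_dim_le V n]].

End Widths.

(* Main.v *)
(** Since [K] is convex and symmetric, its span is the union of the multiples of
    [K]. Hence a basis of a subspace [V] of the closed span can be perturbed into
    multiples of elements of [K]. Only approximants of bounded norm matter, and
    their coordinates are bounded, so the error made on [K] is small; this gives
    the greedy width. For the same reason the useful elements of the span of
    [f_1, ..., f_n] in [K] lie in one dilation hull of [K], so this span competes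
    in the constrained width for large [gamma]. Conversely, intersecting any [V]
    with the span of [K] loses no constrained approximant, so the restricted
    width is at most the constrained one. *)
Require Import Defs.
From HB Require Import structures.
From mathcomp Require Import all_boot all_order all_algebra.
From mathcomp Require Import all_classical all_reals all_analysis.
Set Implicit Arguments.
Unset Strict Implicit.
Unset Printing Implicit Defensive.
Import Order.TTheory GRing.Theory Num.Theory.
Import numFieldNormedType.Exports.
Local Open Scope classical_set_scope.
Local Open Scope ring_scope.

(** * Spans, independent families and dimension *)

Section Spans.
Context {R : realType} {X : lmodType R}.
Implicit Types (A B W : set X) (x y : X).

Lemma submod_closedP W :
  submod_closed (mem W) <->
  W 0 /\ forall (a : R) x y, W x -> W y -> W (a *: x + y).
Proof.
split=> [[W0 WD]|[W0 WD]].
  split=> [|a x y Wx Wy]; first by move: W0; rewrite inE.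
  by have := WD a x y (mem_set Wx) (mem_set Wy); rewrite inE.
split=> [|a x y]; first exact: mem_set.
by rewrite !inE; exact: WD.
Qed.

Lemma submod_closed_sum W (m : nat) (a : 'I_m -> R) (v : 'I_m -> X) :
  submod_closed (mem W) -> (forall i, W (v i)) -> W (\sum_(i < m) a i *: v i).
Proof.
move=> /submod_closedP[W0 WD] Wv; apply: (big_ind W) => // [x y Wx Wy|i _].
  by rewrite -[x]scale1r; exact: WD.
by rewrite -[_ *: _]addr0; exact: WD.
Qed.

Lemma submod_closedI W B : submod_closed (mem W) -> submod_closed (mem B) ->
  submod_closed (mem (W `&` B)).
Proof.
move=> /submod_closedP[W0 WD] /submod_closedP[B0 BD]; apply/submod_closedP.
by split=> // a x y [Wx Bx] [Wy By]; split; [exact: WD|exact: BD].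
Qed.

Lemma subset_lspan A : A `<=` lspan A.
Proof.
move=> x Ax; exists 1%N, (fun=> 1), (fun=> x); split=> //.
by rewrite big_ord1 scale1r.
Qed.

Lemma lspan_submod_closed A : submod_closed (mem (lspan A)).
Proof.
apply/submod_closedP; split.
  by exists 0%N, (fun=> 0), (fun=> 0); split=> [[]//|]; rewrite big_ord0.
move=> c _ _ [m [a [u [Au ->]]]] [p [b [v [Av ->]]]].
exists (m + p)%N,
  (fun i : 'I_(m + p) =>
     match fintype.split i with inl j => c * a j | inr k => b k end),
  (fun i : 'I_(m + p) =>
     match fintype.split i with inl j => u j | inr k => v k end).
split=> [i|]; first by case: (fintype.split i).
rewrite big_split_ord /= scaler_sumr; congr (_ + _).
  by apply: eq_bigr => i _; rewrite (unsplitK (inl i)) scalerA.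
by apply: eq_bigr => i _; rewrite (unsplitK (inr i)).
Qed.

Lemma lspan_sub A W : submod_closed (mem W) -> A `<=` W -> lspan A `<=` W.
Proof.
move=> WW AW _ [m [a [v [Av ->]]]].
by apply: submod_closed_sum => // i; exact: AW.
Qed.

Lemma lspan_rangeP (n : nat) (e : 'I_n -> X) x :
  lspan (range e) x <-> exists a : 'I_n -> R, x = \sum_(i < n) a i *: e i.
Proof.
split=> [[p [b [v [/(_ _)/cid2-/all_sig[g vE] ->]]]]|[a ->]]; last first.
  by apply: submod_closed_sum => [|i];
    [exact: lspan_submod_closed|apply: subset_lspan; exists i].
(* [g] picks for each [v i] an index in the family [e]; the coefficients of all vectors sent to the
   same index are added up. *)
exists (fun j => \sum_(i < p | g i == j) b i).
rewrite (partition_big g xpredT)//=; apply: eq_bigr => j _.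
rewrite scaler_suml; apply: eq_bigr => i /eqP gij.
by have [_ <-] := all_and2 vE; rewrite gij.
Qed.

(** If [n < m], the coordinate matrix of [e'] with respect to [e] has a nonzero row vector in its
    left kernel, and this is a linear relation between the [e' i]. The family [e] may be
    dependent. *)
Lemma lin_indep_size_le (m n : nat) (e : 'I_n -> X) (e' : 'I_m -> X) :
  lin_indep e' -> (forall i, lspan (range e) (e' i)) -> (m <= n)%N.
Proof.
move=> fe' /(_ _)/lspan_rangeP/cid-/all_sig[M e'E].
rewrite leqNgt; apply/negP => nm.
pose A : 'M[R]_(m, n) := \matrix_(i, j) M i j.
have : kermx A != 0.
  rewrite kermx_eq0 /row_free; apply/negP => /eqP rA.
  by move: (rank_leq_col A); rewrite rA leqNgt nm.
move=> /rowV0Pn[u /sub_kermxP uA /negP]; apply; apply/eqP/rowP => i.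
rewrite mxE; apply: (fe' (u 0)).
under eq_bigr do rewrite e'E scaler_sumr.
rewrite exchange_big/= big1// => j _.
under eq_bigr do rewrite scalerA.
rewrite -scaler_suml; have /rowP/(_ j) := uA; rewrite !mxE => uAj.
rewrite (_ : \sum_k _ = 0) ?scale0r// -[RHS]uAj.
by apply: eq_bigr => k _; rewrite mxE.
Qed.

(** A relation whose coefficient at [x] is nonzero could be solved for [x], putting it in the span.
    The new vector takes the last index. *)
Lemma lin_indep_extend (m : nat) (e : 'I_m -> X) x :
  lin_indep e -> ~ lspan (range e) x ->
  lin_indep (fun i : 'I_m.+1 => oapp e x (unlift ord_max i)).
Proof.
move=> fe xe a; rewrite big_ord_recr /= unlift_none /=.
have wE (i : 'I_m) : unlift ord_max (widen_ord (leqnSn m) i) = Some i.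
  by rewrite (_ : widen_ord _ i = lift ord_max i) ?liftK//;
    apply/val_inj; rewrite /= /bump leqNgt ltn_ord.
under eq_bigr do rewrite wE /=.
have [a0|a0] := eqVneq (a ord_max) 0.
  rewrite a0 scale0r addr0 => /fe ae i.
  by case: (unliftP ord_max i) => [j ->|->//]; rewrite -(ae j); congr (a _);
    apply/val_inj; rewrite /= /bump leqNgt ltn_ord.
move=> /eqP; rewrite addrC addr_eq0 => /eqP aE; exfalso; apply: xe.
apply/lspan_rangeP.
exists (fun i => - (a ord_max)^-1 * a (widen_ord (leqnSn m) i)).
under eq_bigr do rewrite -scalerA.
by rewrite -scaler_sumr scaleNr -scalerN -aE scalerA mulVf// scale1r.
Qed.

(** Independent families in [W] have at most [n] members, so one of maximal size exists; it spans
    [W], since otherwise it could be extended. *)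
Lemma subspace_dim_le_sub (n : nat) (e : 'I_n -> X) W :
  submod_closed (mem W) -> W `<=` lspan (range e) -> subspace_dim_le W n.
Proof.
move=> WW We; split=> //.
pose P m := `[< exists e' : 'I_m -> X, lin_indep e' /\ forall i, W (e' i) >].
have P0 : exists m, P m.
  by exists 0%N; apply/asboolP; exists (fun=> 0); split=> [a _ []|[]].
have Pn m : P m -> (m <= n)%N.
  by move=> /asboolP[e' [fe' We']]; apply: (lin_indep_size_le fe') => i;
    exact/We/We'.
case: (ex_maxnP P0 Pn) => m /asboolP[e' [fe' We']] mmax.
exists m; split; first by apply: Pn; apply/asboolP; exists e'.
exists e'; split=> //; apply/seteqP; split.
  by apply: lspan_sub => // _ [i _ <-].
move=> x Wx; apply: contrapT => xe'.
suff /mmax : P m.+1 by rewrite ltnn.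
apply/asboolP; exists (fun i : 'I_m.+1 => oapp e' x (unlift ord_max i)).
by split=> [|i]; [exact: lin_indep_extend|case: (unlift _ i)].
Qed.

Lemma subspace_dim_leS (V W : set X) (n : nat) :
  subspace_dim_le V n -> submod_closed (mem W) -> W `<=` V ->
  subspace_dim_le W n.
Proof.
move=> [_ [m [mn [e [_ eV]]]]] WW; rewrite -eV => We.
have [_ [p [pm dimW]]] := subspace_dim_le_sub WW We.
by split=> //; exists p; split=> //; exact: leq_trans mn.
Qed.

End Spans.

(** * Coordinates in a finite-dimensional subspace *)

Section Coordinates.
Context {R : realType} {X : normedModType R}.

(** The norm of the combination is continuous in the coordinates and, by independence, positive on
    the compact unit sphere. Its minimum [c] there is positive, and by homogeneity [C = c^-1]
    works. *)
Lemma coord_le_norm (m : nat) (e : 'I_m -> X) : lin_indep e ->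
  exists2 C : R, 0 < C &
    forall (a : 'I_m -> R) i, `|a i| <= C * `|\sum_(j < m) a j *: e j|.
Proof.
move=> fe; pose f (a : 'rV[R]_m) : R := `|\sum_(j < m) a 0 j *: e j|.
pose S := [set a : 'rV[R]_m | `|a| = 1].
have fS : continuous f.
  have sC : continuous (fun a : 'rV[R]_m => \sum_(j < m) a 0 j *: e j).
    apply: (@continuous_big X 'I_m +%R 0 xpredT) => [|i _ a].
      exact: add_continuous.
    by apply: cvgZr_tmp; [exact: (@nbhs_filter _ a)|exact: coord_continuous].
  by move=> a; apply: (continuous_comp (sC a)); exact: norm_continuous.
have cS : compact S.
  apply: bounded_closed_compact.
    by exists 1; split=> // c c1 a /= ->; exact: ltW.
  apply: (@preimage_closed _ R Num.norm [set x | x = 1] _ (@closed_eq R 1)).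
  by move=> a _; exact: norm_continuous.
have coordS (a : 'I_m -> R) i : `|a i| <= `|\row_j a j|.
  rewrite [leRHS]/Num.norm /= mx_normrE; apply/bigmax_geP; right.
  by exists (0, i); rewrite //= mxE.
have fZ c a : f (c *: a) = `|c| * f a.
  by rewrite /f -normrZ scaler_sumr; congr `|_|; apply: eq_bigr => j _;
    rewrite mxE scalerA.
have fpos a : S a -> 0 < f a.
  move=> Sa; rewrite lt_neqAle normr_ge0 andbT eq_sym normr_eq0.
  apply/eqP => /fe a0; have : a = 0 by apply/rowP => j; rewrite mxE a0.
  by move=> aE; move: Sa; rewrite /S/= aE normr0 => /esym/eqP; rewrite oner_eq0.
have [c c0 cf] : exists2 c : R, 0 < c & forall a, S a -> c <= f a.
  (* The sphere is empty when [m = 0]; any positive bound then serves. *)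
  have [S0|/set0P S0] := eqVneq S set0.
    by exists 1 => // a; rewrite S0.
  have [a Sa amin] := EVT_min_rV S0 cS (continuous_subspaceT fS).
  by exists (f a) => [|b Sb]; [apply/fpos/set_mem|apply/amin/mem_set].
exists c^-1 => [|a i]; first by rewrite invr_gt0.
rewrite (le_trans (coordS a i))//; set b := \row_j a j.
have -> : \sum_j a j *: e j = \sum_j b 0 j *: e j.
  by apply: eq_bigr => j _; rewrite mxE.
rewrite -/(f b) mulrC ler_pdivlMr//.
have [->|b0] := eqVneq b 0; first by rewrite normr0 mul0r normr_ge0.
have nb : 0 < `|b| by rewrite normr_gt0.
(* A nonzero [b] is written as its norm times a point of the sphere. *)
rewrite -[in leRHS](scalerKV (lt0r_neq0 nb) b).
rewrite fZ normr_id ler_pM2l//; apply: cf.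
by rewrite /S/= normrZ normfV normr_id mulVf// lt0r_neq0.
Qed.

End Coordinates.

(** * Dilation hulls of a symmetric convex set *)

Section SymmetricConvex.
Context {R : realType} {X : completeNormedModType R} (K : set X).
Hypothesis K_nonempty : K !=set0.
Hypothesis K_convex : convex_set (K : set (convex_lmodType X)).
Hypothesis K_symmetric : forall f : X, K f -> K (- f).

Lemma convex_comb (t : R) (x y : X) :
  0 <= t <= 1 -> K x -> K y -> K (t *: x + (1 - t) *: y).
Proof.
move=> t01 Kx Ky.
have /set_mem := K_convex (Itv01 (proj1 (andP t01)) (proj2 (andP t01)))
  (mem_set Kx) (mem_set Ky).
exact.
Qed.

Lemma symconvex0 : K 0.
Proof.
case: K_nonempty => x Kx.
(* The origin is the midpoint of [x] and [- x]. *)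
have /convex_comb/(_ Kx (K_symmetric Kx)) : 0 <= (2^-1 : R) <= 1.
  by rewrite invr_ge0 ler0n invf_le1// ler1n.
by rewrite scalerN -scalerBl (_ : _ - _ = 0) ?scale0r//; apply/eqP;
  rewrite subr_eq0 {2}(splitr 1) mul1r addrK.
Qed.

Lemma dilation_hull0 (c : R) : 0 <= c -> dilation_hull c K 0.
Proof.
by move=> c0; exists 0, 0; split=> //; [exact: symconvex0|rewrite scaler0].
Qed.

Lemma dilation_hull_ge0 (c : R) x : dilation_hull c K x -> 0 <= c.
Proof. by case=> l [f [l0 lc _ _]]; exact: le_trans lc. Qed.

Lemma dilation_hullS (c d : R) : c <= d ->
  dilation_hull c K `<=` dilation_hull d K.
Proof.
by move=> cd x [l [f [l0 lc Kf ->]]]; exists l, f; split=> //; exact: le_trans cd.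
Qed.

(** By convexity, [l *: f + k *: g] is [l + k] times the weighted mean of [f] and [g]; the case
    [l + k = 0] is treated apart. *)
Lemma dilation_hullD (c d : R) x y : dilation_hull c K x ->
  dilation_hull d K y -> dilation_hull (c + d) K (x + y).
Proof.
move=> [l [f [l0 lc Kf ->]]] [k [g [k0 kd Kg ->]]].
have [lk0|lk0] := eqVneq (l + k) 0.
  move/eqP: lk0; rewrite paddr_eq0// => /andP[/eqP-> /eqP->].
  rewrite !scale0r addr0; apply: dilation_hull0.
  by rewrite addr_ge0//; [exact: le_trans lc|exact: le_trans kd].
have lk : 0 < l + k by rewrite lt_neqAle eq_sym lk0 addr_ge0.
exists (l + k), (l / (l + k) *: f + (1 - l / (l + k)) *: g); split.
- by rewrite ltW.
- exact: lerD.
- apply: convex_comb => //.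
  by rewrite divr_ge0 ?(ltW lk)//= ler_pdivrMr// mul1r lerDl.
- rewrite scalerDr !scalerA mulrBr mulr1 mulrCA divff// mulr1.
  by rewrite [l + k - l]addrC addKr.
Qed.

Lemma dilation_hullZ (a c : R) x : dilation_hull c K x ->
  dilation_hull (`|a| * c) K (a *: x).
Proof.
move=> [l [f [l0 lc Kf ->]]].
(* Dilation factors are nonnegative, so the sign of [a] is moved onto [f] by symmetry. *)
exists (`|a| * l), (if 0 <= a then f else - f).
split; rewrite ?mulr_ge0// ?ler_wpM2l//; case: ifPn => //.
- by move=> _; exact: K_symmetric.
- by move=> a0; rewrite ger0_norm// scalerA.
- rewrite -ltNge => a0.
  by rewrite ltr0_norm// mulNr scalerN scaleNr opprK scalerA.
Qed.

Lemma dilation_hull_sum (m : nat) (a c : 'I_m -> R) (v : 'I_m -> X) :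
  (forall i, dilation_hull (c i) K (v i)) ->
  dilation_hull (\sum_(i < m) `|a i| * c i) K (\sum_(i < m) a i *: v i).
Proof.
move=> Kv; elim/big_ind2 : _ => [|c1 x1 c2 x2|i _]; first exact: dilation_hull0.
  exact: dilation_hullD.
exact: dilation_hullZ.
Qed.

Lemma dilation_hull_lspan (c : R) : dilation_hull c K `<=` lspan K.
Proof.
move=> _ [l [f [_ _ Kf ->]]].
by exists 1%N, (fun=> l), (fun=> f); split=> //; rewrite big_ord1.
Qed.

(** Each generator lies in the hull of factor [1], and hull factors add up along linear
    combinations. *)
Lemma lspan_dilation_hull x : lspan K x -> exists c : R, dilation_hull c K x.
Proof.
move=> [m [a [v [Kv ->]]]]; exists (\sum_(i < m) `|a i| * 1).
apply: dilation_hull_sum => i; exists 1, (v i).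
by split=> //; rewrite scale1r.
Qed.

End SymmetricConvex.

(** * Comparison of the three widths *)

Section WidthComparisons.
Context {R : realType} {X : completeNormedModType R} (K : set X).

Lemma deviationS (A B : set X) : A `<=` B ->
  (deviation K B <= deviation K A)%E.
Proof.
move=> AB; apply: ge_ereal_sup => _ [f Kf <-].
apply: le_ereal_sup_tmp; exists (dist f A); first by exists f.
by apply: ereal_inf_le_tmp => _ [v Av <-]; exists v => //; exact: AB.
Qed.

(* An approximant [v] of [f] with [|v| > 2 |f|] does no better than [0]. *)
Lemma deviation_le_bounded (A B : set X) (M c : R) :
  (forall f, K f -> `|f| <= M) -> B 0 -> 0 <= c ->
  (forall v, A v -> `|v| <= 2 * M -> exists2 w, B w & `|v - w| <= c) ->
  (deviation K B <= deviation K A + c%:E)%E.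
Proof.
move=> KM B0 c0 AB; apply: ge_ereal_sup => _ [f Kf <-].
apply: (@le_trans _ _ (dist f A + c%:E)%E); last first.
  by rewrite leeD2r//; apply: le_ereal_sup_tmp; exists (dist f A) => //; exists f.
rewrite -leeBlDr//; apply: le_ereal_inf_tmp => _ [v Av <-].
rewrite leeBlDr// -EFinD.
suff [w Bw fw] : exists2 w, B w & `|f - w| <= `|f - v| + c.
  by apply: ge_ereal_inf; exists `|f - w|%:E; [exists w|rewrite lee_fin].
have [vM|vM] := leP `|v| (2 * M).
  have [w Bw vw] := AB _ Av vM; exists w => //.
  by rewrite -(subrKA v) (le_trans (ler_normD _ _))// lerD2l.
exists 0 => //; rewrite subr0 (le_trans (KM _ Kf))//.
have : `|v| - `|f| <= `|f - v| by rewrite distrC lerB_dist.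
move=> vf; have fM := KM _ Kf.
rewrite ler_wpDr// (le_trans _ vf)// lerBrDr (le_trans _ (ltW vM))//.
by rewrite mulr_natl mulr2n lerD2l.
Qed.

Hypothesis K_nonempty : K !=set0.
Hypothesis K_compact : compact K.
Hypothesis K_convex : convex_set (K : set (convex_lmodType X)).
Hypothesis K_symmetric : forall f : X, K f -> K (- f).

Lemma compact_norm_le : exists2 M : R, 0 < M & forall f, K f -> `|f| <= M.
Proof.
have [M [_ KM]] := compact_bounded K_compact.
exists (`|M| + 1) => [|f Kf]; first by rewrite ltr_wpDl.
by apply: KM => //; rewrite (le_lt_trans (ler_norm M))// ltrDl.
Qed.

Lemma width_restricted_le_greedy (n : nat) :
  (width_restricted K n <= width_greedy K n)%E.
Proof.
apply: le_ereal_inf_tmp => _ [f Kf <-]; apply: ereal_inf_lbound.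
exists (lspan (range f)) => //; split; last first.
  by apply: (@subspace_dim_le_sub _ _ _ f) => //; exact: lspan_submod_closed.
apply: subset_trans (@subset_closure _ _).
apply: lspan_sub; first exact: lspan_submod_closed.
by move=> _ [i _ <-]; exact/subset_lspan/Kf.
Qed.

(** Each [e i] is a multiple of an element of [K]. The greedy width asks for exactly [n] elements,
    so the remaining places are filled with [0], which lies in [K]. *)
Lemma lspan_family (m n : nat) (e : 'I_m -> X) : (m <= n)%N ->
  (forall i, lspan K (e i)) ->
  exists2 f : 'I_n -> X, (forall j, K (f j)) &
    forall i, lspan (range f) (e i).
Proof.
move=> mn /(_ _)/(lspan_dilation_hull K_nonempty K_convex K_symmetric).
move=> /(_ _)/cid-/all_sig[c /(_ _)/cid-/all_sig[l /(_ _)/cid-/all_sig[k ke]]].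
exists (fun j : 'I_n => oapp k 0 (insub (val j))) => [j|i].
  case: insubP => [i _ _|_] /=; last exact: symconvex0.
  by case: (ke i).
have [_ _ _ ->] := ke i.
rewrite -[_ *: _]addr0.
have [/= S0 SD] := (submod_closedP _).1 (@lspan_submod_closed _ _
  (range (fun j : 'I_n => oapp k 0 (insub (val j) : option 'I_m)))).
apply: SD => //; apply: subset_lspan; exists (widen_ord mn i) => //=.
by rewrite valK.
Qed.

(* A basis of [V] is perturbed into the span of [K], which consists of multiples
   of elements of [K]; bounded coordinates keep the perturbation small. *)
Lemma width_greedy_le_restricted (n : nat) :
  (width_greedy K n <= width_restricted K n)%E.
Proof.
apply: le_ereal_inf_tmp => _ [V [VK [_ [m [mn [e [fe eV]]]]]] <-].
apply/lee_addgt0Pr => eps eps0.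
have [C C0 eC] := coord_le_norm fe.
have [M M0 KM] := compact_norm_le.
have CM0 : 0 < C * (2 * M) by rewrite !mulr_gt0.
(* The [m] basis vectors contribute at most [C * (2 * M) * d] each, in total at most [eps]; [m.+1]
   keeps the denominator nonzero when [m = 0]. *)
pose d := eps / (m.+1%:R * (C * (2 * M))).
have d0 : 0 < d by rewrite divr_gt0// mulr_gt0.
have /(_ _)/cid2-/all_sig[e' e'P] i : exists2 y, lspan K y & `|e i - y| < d.
  have /VK/(_ _ (nbhsx_ballx _ _ d0))[y [Ky]] : V (e i).
    by rewrite -eV; apply: subset_lspan; exists i.
  by rewrite -ball_normE /= => ye; exists y.
have [e'K e'd] := all_and2 e'P.
have [f Kf fe'] := lspan_family mn e'K.
apply: (@le_trans _ _ (deviation K (lspan (range f)))).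
  by apply: ereal_inf_lbound; exists f.
have [S0 _] := (submod_closedP _).1 (@lspan_submod_closed _ _ (range f)).
apply: (deviation_le_bounded KM S0 (ltW eps0)) => v.
rewrite -eV => /lspan_rangeP[a ->] vM.
exists (\sum_i a i *: e' i).
  by apply: submod_closed_sum => //; exact: lspan_submod_closed.
rewrite -sumrB (le_trans (ler_norm_sum _ _ _))//.
apply: (@le_trans _ _ (\sum_(i < m) C * (2 * M) * d)).
  apply: ler_sum => i _; rewrite -scalerBr normrZ ler_pM//; last exact/ltW.
  by rewrite (le_trans (eC a i))// ler_wpM2l// ltW.
rewrite sumr_const card_ord -[leLHS]mulr_natl /d mulrA mulrCA -[leRHS]mulr1.
by rewrite ler_pM2l// ler_pdivrMr ?mulr_gt0// mul1r ler_pM2r// ler_nat.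
Qed.

Lemma width_restricted_le_constrained (n : nat) (c : R) :
  (width_restricted K n <= width_constrained K n c)%E.
Proof.
apply: le_ereal_inf_tmp => _ [V VV <-].
apply: ge_ereal_inf; exists (deviation K (V `&` lspan K)); last first.
  by apply: deviationS; apply: setIS; exact: dilation_hull_lspan.
exists (V `&` lspan K) => //; split.
  by apply: subset_trans (@subset_closure _ _) => x [].
apply: (subspace_dim_leS VV) => [|x []//].
by apply: submod_closedI; [case: VV|exact: lspan_submod_closed].
Qed.

(** The [gamma] found depends on the chosen family [f], hence the infimum over [gamma]. *)
Lemma inf_constrained_le_greedy (n : nat) :
  (ereal_inf (range (width_constrained K n)) <= width_greedy K n)%E.
Proof.
apply: le_ereal_inf_tmp => _ [f Kf <-].
have fV : subspace_dim_le (lspan (range f)) n.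
  by apply: (@subspace_dim_le_sub _ _ _ f) => //; exact: lspan_submod_closed.
have [_ [m [_ [e [fe eV]]]]] := fV.
have [C C0 eC] := coord_le_norm fe.
have [M M0 KM] := compact_norm_le.
have /(_ _)/cid-/all_sig[c ec] i : exists c, dilation_hull c K (e i).
  apply: (lspan_dilation_hull K_nonempty K_convex K_symmetric).
  apply: (@lspan_sub _ _ (range f)); first exact: lspan_submod_closed.
    by move=> _ [j _ <-]; exact/subset_lspan/Kf.
  by rewrite -eV; apply: subset_lspan; exists i.
have c0 i : 0 <= c i := dilation_hull_ge0 (ec i).
(* Approximants of norm at most [2 * M] have coordinates at most [C * (2 * M)] in absolute value, so
   all of them lie in the hull of factor [g]. *)
pose g := \sum_(i < m) (C * (2 * M)) * c i.
apply: (@le_trans _ _ (width_constrained K n g)).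
  by apply: ereal_inf_lbound; exists g.
apply: (@le_trans _ _ (deviation K (lspan (range f) `&` dilation_hull g K))).
  by apply: ereal_inf_lbound; exists (lspan (range f)).
(* Bounded approximants are kept unchanged, so the allowed error is [0]. *)
rewrite -[leRHS]adde0; apply: (deviation_le_bounded KM) => //.
  split; first by have [] := (submod_closedP _).1 fV.1.
  apply: dilation_hull0 => //.
  by apply: sumr_ge0 => i _; rewrite !mulr_ge0// ltW.
move=> v Vv vM; exists v; last by rewrite subrr normr0.
split=> //; move: Vv vM; rewrite -eV => /lspan_rangeP[a ->] vM.
apply: dilation_hullS (dilation_hull_sum K_nonempty K_convex K_symmetric a ec).
apply: ler_sum => i _; rewrite ler_wpM2r//.
by rewrite (le_trans (eC a i))// ler_wpM2l// ltW.
Qed.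

Lemma width_constrained_nonincreasing (n : nat) :
  {homo width_constrained K n : c d / c <= d >-> (d <= c)%E}.
Proof.
move=> c d cd; apply: le_ereal_inf_tmp => _ [V VV <-].
apply: ge_ereal_inf; exists (deviation K (V `&` dilation_hull d K)).
  by exists V.
by apply: deviationS; apply: setIS; exact: dilation_hullS.
Qed.

End WidthComparisons.

Theorem theorem4p1 (R : realType) (X : completeNormedModType R) (K : set X)
  (K_nonempty : K !=set0)
  (K_compact : compact K)
  (K_convex : convex_set (K : set (convex_lmodType X)))
  (K_symmetric : forall f : X, K f -> K (- f))
  (n : nat) (n_ge1 : (1 <= n)%N) :
  width_restricted K n = width_greedy K n /\
  width_constrained K n gamma @[gamma --> +oo%R] --> width_greedy K n.
Proof.
have rg : width_restricted K n = width_greedy K n.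
  by apply/eqP; rewrite eq_le width_restricted_le_greedy
    width_greedy_le_restricted.
split=> //.
(* A nonincreasing function tends to its infimum at [+oo]. Negative [gamma] are harmless: the hull
   is then empty and the width is [+oo]. *)
suff <- : ereal_inf (range (width_constrained K n)) = width_greedy K n.
  by apply: nonincreasing_cvge; exact: width_constrained_nonincreasing.
apply/eqP; rewrite eq_le inf_constrained_le_greedy//= -rg.
by apply: le_ereal_inf_tmp => _ [c _ <-]; exact: width_restricted_le_constrained.
Qed.
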